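(* Let $b>0$, $d\in\mathbb{N}^*$, and let $(G_n)_{n\ge0}$, $G_n=(V_n,E_n)$, be a $(b,d)$-expander. Let $\alpha\in\,]0,1/2[$ and $c\in\,]0,1[$. There is a constant $C_3$, depending only on $c$, $\alpha$, $b$ and $d$, such that for any $n$, \[ p_{n,1-\alpha}(c)-p_{n,\alpha}(c)\leq \frac{C_3}{(\log |V_n|)^{1/3}}. \]
   Context: For a finite graph $G=(V,E)$, $E(A,B)$ is the set of edges with one endpoint in $A$ and the other in $B$, and the Cheeger constant is $c(G)=\min_{A\subset V,\,0<|A|\le |V|/2} |E(A,A^c)|/|A|$. A $(b,d)$-expander is a sequence of finite graphs $G_n=(V_n,E_n)$ such that for every $n$ the maximal degree of $G_n$ is at most $d$ and $c(G_n)>b$, with $|V_n|\to\infty$. Configurations $x\in\{0,1\}^{E_n}$ are identified with the spanning subgraph of $G_n$ keeping exactly the edges $e$ with $x(e)=1$; $\mu_{n,p}$ is the product measure on $\{0,1\}^{E_n}$ under which each $x(e)$ is independently $1$ with probability $p$ and $0$ with probability $1-p$. $L_n^{(1)}(x)$ is the number of vertices of the largest connected component of $x$. For $c\in]0,1[$ and $\alpha\in[0,1]$, $p_{n,\alpha}(c)$ is the unique $p\in[0,1]$ such that $\mu_{n,p}(L_n^{(1)}\ge c|V_n|)=\alpha$. *)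

(* Defs.v *)
From HB Require Import structures.
From mathcomp Require Import all_boot all_order all_algebra.
From mathcomp Require Import reals exp.
Set Implicit Arguments. Unset Strict Implicit. Unset Printing Implicit Defensive.
Import Order.TTheory GRing.Theory Num.Theory.
Local Open Scope ring_scope.

Record sgraph := SGraph {
  vert : finType;
  adj : rel vert;
  adj_sym : symmetric adj;
  adj_irr : irreflexive adj }.

Definition edges (G : sgraph) : {set {set vert G}} :=
  [set e : {set vert G} | [exists x, exists y, adj x y && (e == [set x; y])]].

Definition degree (G : sgraph) (x : vert G) : nat := #|[set y | adj x y]|.
Definition maxdeg_le (G : sgraph) (d : nat) : Prop :=
  forall x : vert G, (degree x <= d)%N.

Definition boundary_size (G : sgraph) (A : {set vert G}) : nat :=
  #|[set e in edges G | [exists x in A, exists y in ~: A, e == [set x; y]]]|.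

(* c(G) > b, where c(G) = min over 0 < |A| <= |V|/2 of |E(A,A^c)|/|A|;
   since the minimum ranges over a finite set, this says every ratio is > b. *)
Definition cheeger_gt {R : realType} (G : sgraph) (b : R) : Prop :=
  forall A : {set vert G}, (0 < #|A|)%N -> (#|A| * 2 <= #|vert G|)%N ->
    b < (boundary_size A)%:R / (#|A|)%:R.

Definition expander {R : realType} (b : R) (d : nat) (G : nat -> sgraph) : Prop :=
  [/\ forall n, maxdeg_le (G n) d,
      forall n, cheeger_gt (G n) b
    & forall M : nat, exists N, forall n, (N <= n)%N -> (M <= #|vert (G n)|)%N].

(* A configuration is identified with the set of kept edges (a subset of E).
   Connectivity in the spanning subgraph of kept edges. *)
Definition open_rel (G : sgraph) (w : {set {set vert G}}) : rel (vert G) :=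
  fun x y => [set x; y] \in (w :&: edges G).

Definition largest_cluster (G : sgraph) (w : {set {set vert G}}) : nat :=
  \max_(x : vert G) #|[set y | connect (open_rel w) x y]|.

(* mu_{p}(L^(1) >= c |V|) for the Bernoulli(p) product measure on {0,1}^E. *)
Definition prob_giant {R : realType} (G : sgraph) (p c : R) : R :=
  \sum_(w in powerset (edges G) |
          c * (#|vert G|)%:R <= (largest_cluster w)%:R)
     p ^+ #|w| * (1 - p) ^+ #|edges G :\: w|.

(* Main.v *)
(* Fix a threshold M = eps |V| and let g be the number of vertices lying in
   clusters of at least M vertices.  Changing one edge changes g by at most 2M,
   so Efron-Stein and Russo give Var g <= 2M (E g)'; as E g is monotone with
   range [0, |V|], the variance of g / |V| is O(eps / w) at some p of every
   interval of length w.  On the other hand the edges leaving the large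
   clusters are closed, and there are at least b min(g, |V| - g) of them, so
   E g / |V| grows at linear rate in p as long as it stays away from 0 and 1.
   If the probability of [L1 >= c |V|] stays in [alpha, 1 - alpha] on an
   interval of length w, E g / |V| remains within O(sqrt (eps / w)) of c there,
   whence w^3 = O(eps).

   This uses that {g >= c |V|} and {L1 >= c |V|} nearly coincide, i.e. that two
   large clusters seldom coexist.  A closed edge joining two of them raises the
   sum of |cluster x| over x by at least M^2 when opened, so by Russo the mean
   number of such edges is small for most p.  By expansion, two large clusters
   yield at least M / 2 vertices within distance O(1 / eps) of another large
   cluster, and opening the edges of the connecting path one at a time, at a
   cost 1 / p each, produces an edge joining two large clusters.  The choice
   eps = K / log |V| makes the total cost a small power of |V|. *)
Require Import Defs.
From HB Require Import structures.
From mathcomp Require Import all_boot all_order all_algebra.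
From mathcomp Require Import reals exp.
From mathcomp Require Import polyrcf ring lra zify.
Set Implicit Arguments. Unset Strict Implicit. Unset Printing Implicit Defensive.
Import Order.TTheory GRing.Theory Num.Theory.
Local Open Scope ring_scope.

(** * Product measures *)

Section ProductMeasure.
Variables (R : rcfType) (T : finType).
Implicit Types (s : seq T) (p : R) (F H : {set T} -> R) (w : {set T}) (e : T).

(** The mean of [F] is built as a polynomial in the edge probability, so that its derivative is
    formal and the mean value theorem for polynomials applies. *)
Fixpoint exp_poly s F : {poly R} :=
  if s is e :: s' then
    (1 - 'X) * exp_poly s' F + 'X * exp_poly s' (fun w => F (e |: w))
  else (F set0)%:P.

Definition expect s p F := (exp_poly s F).[p].
Definition dexpect s p F := (exp_poly s F)^`().[p].

Lemma expect_nil p F : expect [::] p F = F set0.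
Proof. by rewrite /expect /= hornerC. Qed.

Lemma expect_cons e s p F : expect (e :: s) p F =
  (1 - p) * expect s p F + p * expect s p (fun w => F (e |: w)).
Proof. by rewrite /expect /= !hornerE. Qed.

Lemma dexpect_nil p F : dexpect [::] p F = 0.
Proof. by rewrite /dexpect /= derivC horner0. Qed.

Lemma dexpect_cons e s p F : dexpect (e :: s) p F =
  expect s p (fun w => F (e |: w)) - expect s p F +
  ((1 - p) * dexpect s p F + p * dexpect s p (fun w => F (e |: w))).
Proof.
rewrite /dexpect /expect /= derivD !derivM derivB derivX (derivC 1).
rewrite !(hornerD, hornerM, hornerN, hornerX, hornerC, horner0); ring.
Qed.

Lemma eq_expect s p F H : F =1 H -> expect s p F = expect s p H.
Proof.
elim: s F H => [|e s IH] F H eFH; first by rewrite !expect_nil.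
rewrite !expect_cons (IH _ _ eFH); congr (_ + _ * _).
by apply: IH => w; apply: eFH.
Qed.

Lemma expectD s p F H :
  expect s p (fun w => F w + H w) = expect s p F + expect s p H.
Proof.
elim: s F H => [|e s IH] F H; first by rewrite !expect_nil.
by rewrite !expect_cons !IH; ring.
Qed.

Lemma expectZ s p a F : expect s p (fun w => a * F w) = a * expect s p F.
Proof.
elim: s F => [|e s IH] F; first by rewrite !expect_nil.
by rewrite !expect_cons !IH; ring.
Qed.

Lemma expectB s p F H :
  expect s p (fun w => F w - H w) = expect s p F - expect s p H.
Proof.
rewrite expectD; congr (_ + _); rewrite -mulN1r -expectZ.
by apply: eq_expect => w; rewrite mulN1r.
Qed.

Lemma expect_cst s p a : expect s p (fun=> a) = a.
Proof.
elim: s => [|e s IH]; first by rewrite expect_nil.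
by rewrite expect_cons IH; ring.
Qed.

Lemma expect_sum s p (I : Type) (r : seq I) (P : pred I)
    (F : I -> {set T} -> R) :
  expect s p (fun w => \sum_(i <- r | P i) F i w) =
  \sum_(i <- r | P i) expect s p (F i).
Proof.
elim: r => [|i r IH].
  by rewrite big_nil (eq_expect _ _ (H := fun=> 0)) ?expect_cst // => w; rewrite big_nil.
rewrite big_cons -IH; case: ifP => Pi.
  by rewrite -expectD; apply: eq_expect => w; rewrite big_cons Pi.
by apply: eq_expect => w; rewrite big_cons Pi.
Qed.

Lemma le_expect s p F H : 0 <= p <= 1 -> (forall w, F w <= H w) ->
  expect s p F <= expect s p H.
Proof.
move=> /andP[p0 p1]; elim: s F H => [|e s IH] F H leFH.
  by rewrite !expect_nil.
by rewrite !expect_cons lerD // ler_wpM2l ?subr_ge0 ?IH.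
Qed.

Lemma expect_ge0 s p F : 0 <= p <= 1 -> (forall w, 0 <= F w) ->
  0 <= expect s p F.
Proof. by move=> p01 F0; rewrite -(expect_cst s p 0); apply: le_expect. Qed.

Lemma sqr_expect_le s p F : 0 <= p <= 1 ->
  expect s p F ^+ 2 <= expect s p (fun w => F w ^+ 2).
Proof.
move=> p01; set m := expect s p F.
have: 0 <= expect s p (fun w => (F w - m) ^+ 2).
  by apply: expect_ge0 => // w; rewrite sqr_ge0.
have -> : expect s p (fun w => (F w - m) ^+ 2) =
    expect s p (fun w => F w ^+ 2 + ((- (2 * m)) * F w + m ^+ 2)).
  by apply: eq_expect => w; ring.
rewrite expectD expectD expectZ expect_cst -/m; lra.
Qed.

(** * Monotone functions: variance bound and Russo's formula *)

Definition nondecr_on s F :=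
  forall e w, e \in s -> F w <= F (e |: w).

Lemma nondecr_on_behead e s F : nondecr_on (e :: s) F -> nondecr_on s F.
Proof. by move=> mF f w fs; apply: mF; rewrite inE fs orbT. Qed.

Lemma nondecr_on_shift e s F : nondecr_on (e :: s) F ->
  nondecr_on s (fun w => F (e |: w)).
Proof.
by move=> mF f w fs; rewrite setUCA; apply: mF; rewrite inE fs orbT.
Qed.

Lemma dexpect_ge0 s p F : 0 <= p <= 1 -> nondecr_on s F -> 0 <= dexpect s p F.
Proof.
move=> p01; case/andP: (p01) => p0 p1.
elim: s F => [|e s IH] F mF; first by rewrite dexpect_nil.
rewrite dexpect_cons addr_ge0 //.
  by rewrite subr_ge0 le_expect // => w; apply: mF; rewrite mem_head.
rewrite addr_ge0 // mulr_ge0 ?subr_ge0 ?IH //.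
  exact: nondecr_on_behead mF.
exact: nondecr_on_shift mF.
Qed.

(** The variance splits into the conditional variances given the first edge and the variance between
    the two conditional means. Increments lie in [[0, K]], so their squares are at most [K] times
    themselves; hence the last term is at most [K] times the mean increment, which is the new term
    of the derivative. *)
Lemma efron_stein s p F K : 0 <= p <= 1 -> 0 <= K -> nondecr_on s F ->
  (forall e w, e \in s -> F (e |: w) - F w <= K) ->
  expect s p (fun w => F w ^+ 2) - expect s p F ^+ 2 <= K * dexpect s p F.
Proof.
move=> p01 K0; case/andP: (p01) => p0 p1.
elim: s F => [|e s IH] F mF FK.
  by rewrite !expect_nil dexpect_nil mulr0 subrr.
rewrite !expect_cons dexpect_cons.
have h0 := IH _ (nondecr_on_behead mF)
  (fun f w fs => FK f w (mem_behead (s := e :: s) fs)).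
have h1 : expect s p (fun w => F (e |: w) ^+ 2) -
    expect s p (fun w => F (e |: w)) ^+ 2 <=
    K * dexpect s p (fun w => F (e |: w)).
  apply: IH; first exact: nondecr_on_shift mF.
  by move=> f w fs; rewrite setUCA; apply: FK; rewrite inE fs orbT.
have h2 : (expect s p (fun w => F (e |: w)) - expect s p F) ^+ 2 <=
    K * (expect s p (fun w => F (e |: w)) - expect s p F).
  rewrite -expectB; apply: le_trans (sqr_expect_le _ _ p01) _.
  rewrite -expectZ; apply: le_expect => // w.
  rewrite expr2 ler_wpM2r // ?FK ?mem_head // subr_ge0.
  by apply: mF; rewrite mem_head.
set a0 := expect s p F in h0 h2 *; set a1 := expect s p (fun w => F (e |: w)) in h1 h2 *.
set v0 := expect s p (fun w => F w ^+ 2) in h0 *.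
set v1 := expect s p (fun w => F (e |: w) ^+ 2) in h1 *.
set d0 := dexpect s p F in h0 *; set d1 := dexpect s p (fun w => F (e |: w)) in h1 *.
have -> : (1 - p) * v0 + p * v1 - ((1 - p) * a0 + p * a1) ^+ 2 =
   (1 - p) * (v0 - a0 ^+ 2) + p * (v1 - a1 ^+ 2) + p * (1 - p) * (a1 - a0) ^+ 2 by ring.
have e0 : (1 - p) * (v0 - a0 ^+ 2) <= (1 - p) * (K * d0) by rewrite ler_wpM2l // subr_ge0.
have e1 : p * (v1 - a1 ^+ 2) <= p * (K * d1) by rewrite ler_wpM2l.
have e2 : p * (1 - p) * (a1 - a0) ^+ 2 <= (a1 - a0) ^+ 2.
  rewrite ler_piMl ?sqr_ge0 //; nra.
lra.
Qed.

(** The sum may run over all edges because an open edge has zero increment; an edge is closed with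
    probability [1 - p], independently of the increment it would cause, whence the factor. *)
Lemma russo s p F :
  (1 - p) * dexpect s p F =
  expect s p (fun w => \sum_(e <- s) (F (e |: w) - F w)).
Proof.
elim: s F => [|e s IH] F.
  by rewrite dexpect_nil expect_nil big_nil mulr0.
rewrite dexpect_cons expect_cons.
have -> : expect s p (fun w => \sum_(f <- e :: s) (F (f |: w) - F w)) =
    expect s p (fun w => F (e |: w)) - expect s p F + (1 - p) * dexpect s p F.
  by rewrite IH -expectB -expectD; apply: eq_expect => w; rewrite big_cons.
have -> : expect s p (fun w => \sum_(f <- e :: s) (F (f |: (e |: w)) - F (e |: w))) =
    (1 - p) * dexpect s p (fun w => F (e |: w)).
  rewrite IH; apply: eq_expect => w; rewrite big_cons setUA setUid subrr add0r.
  by apply: eq_bigr => f _; rewrite setUCA.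
ring.
Qed.

(** Keep only the event that [e] is open, of probability [p]: inserting [e] changes nothing there,
    and the discarded part is nonnegative. *)
Lemma expect_insert s p F e : 0 <= p <= 1 -> (forall w, 0 <= F w) -> e \in s ->
  p * expect s p (fun w => F (e |: w)) <= expect s p F.
Proof.
move=> p01; case/andP: (p01) => p0 p1.
elim: s F => [//|f s IH] F F0; rewrite inE => /predU1P[<-|es].
  rewrite !expect_cons.
  rewrite (eq_expect s p (F := fun w => F (e |: (e |: w))) (H := fun w => F (e |: w))); last first.
    by move=> w; rewrite setUA setUid.
  rewrite -[X in p * X <= _](_ : expect s p (fun w => F (e |: w)) = _); last by ring.
  by rewrite lerDr mulr_ge0 ?subr_ge0 // expect_ge0.
rewrite !expect_cons mulrDr !(mulrCA p).
rewrite lerD // ler_wpM2l ?subr_ge0 ?IH //.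
rewrite (eq_expect s p (H := fun w => F (f |: (e |: w)))); last by move=> w; rewrite setUCA.
exact: (IH (fun w => F (f |: w))).
Qed.

Lemma expect_card_le s p : 0 <= p <= 1 ->
  expect s p (fun w => #|w|%:R) <= p * (size s)%:R.
Proof.
move=> p01; case/andP: (p01) => p0 p1.
elim: s => [|e s IH]; first by rewrite expect_nil cards0 mulr0.
rewrite expect_cons /=.
have : expect s p (fun w => #|e |: w|%:R) <= 1 + expect s p (fun w => #|w|%:R).
  rewrite -[X in X + _](expect_cst s p) -expectD; apply: le_expect => // w.
  by rewrite cardsU1 natrD lerD2r; case: (_ \notin _); rewrite ?ler01.
move=> h; have : p * expect s p (fun w => #|e |: w|%:R) <= p * (1 + expect s p (fun w => #|w|%:R)).
  by rewrite ler_wpM2l.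
rewrite -(addn1 (size s)) natrD; lra.
Qed.

Lemma expectE s p F : uniq s -> expect s p F =
  \sum_(w in powerset [set x in s]) F w * (p ^+ #|w| * (1 - p) ^+ #|[set x in s] :\: w|).
Proof.
elim: s F => [|e s IH] F /=.
  move=> _; rewrite expect_nil (_ : [set x in [::]] = set0); last by apply/setP => x; rewrite !inE.
  by rewrite powerset0 big_set1 set0D cards0 !expr0 !mulr1.
move=> /andP[nes us]; rewrite expect_cons !IH //.
set S := [set x in s]; have nS : e \notin S by rewrite inE.
have -> : [set x in e :: s] = e |: S by apply/setP => x; rewrite !inE.
rewrite [RHS](bigID (fun w : {set T} => e \in w)) /= addrC; congr (_ + _).
  rewrite big_distrr /=; apply: eq_big => [w|w].
    rewrite !powersetE; apply/idP/andP => [wS|[wS ew]].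
      split; first exact: subset_trans wS (subsetU1 _ _).
      by apply: contra nS => /(subsetP wS).
    apply/subsetP => x xw; have := subsetP wS _ xw.
    by rewrite !inE => /predU1P[xe|//]; rewrite -xe xw in ew.
  rewrite powersetE => wS; have nw : e \notin w by apply: contra nS => /(subsetP wS).
  have -> : (e |: S) :\: w = e |: (S :\: w).
    by apply/setP => x; rewrite !inE; case: eqP => //= ->; rewrite nw.
  by rewrite cardsU1 !inE (negPf nes) andbF /= exprS; ring.
rewrite [RHS](reindex_onto (fun w => e |: w) (fun w => w :\ e)) /=; last first.
  by move=> w /andP[_ ew]; rewrite setD1K.
rewrite big_distrr /=; apply: eq_big => [w|w].
  rewrite !powersetE setU11 andbT; apply/idP/andP => [wS|[wS /eqP ew]].
    have nw : e \notin w by apply: contra nS => /(subsetP wS).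
    by split; [exact: setUS | rewrite setU1K].
  have nw : e \notin w by rewrite -ew !inE eqxx.
  apply/subsetP => x xw; have := subsetP wS x; rewrite !inE xw orbT => /(_ isT).
  by case/predU1P => // xe; rewrite -xe xw in nw.
rewrite powersetE => wS; have nw : e \notin w by apply: contra nS => /(subsetP wS).
have -> : (e |: S) :\: (e |: w) = S :\: w.
  apply/setP => x; rewrite !inE; case: eqP => //= ->.
  by rewrite (negPf nes) andbF.
by rewrite cardsU1 nw /= exprS; ring.
Qed.

Lemma expect_mvt s a b F : a < b ->
  exists2 q, a < q < b & expect s b F - expect s a F = dexpect s q F * (b - a).
Proof.
move=> ab; have [q qab E] := poly_mvt (exp_poly s F) ab.
by exists q => //; move: qab; rewrite in_itv.
Qed.

Lemma expect_homo s a b F : 0 <= a -> a <= b -> b <= 1 -> nondecr_on s F ->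
  expect s a F <= expect s b F.
Proof.
move=> a0; rewrite le_eqVlt => /predU1P[-> //|ab] b1 mF.
have [q /andP[aq qb] E] := expect_mvt s F ab.
rewrite -subr_ge0 E mulr_ge0 ?subr_ge0 ?(ltW ab) // dexpect_ge0 //; lra.
Qed.

Lemma dexpectD s p F H :
  dexpect s p (fun w => F w + H w) = dexpect s p F + dexpect s p H.
Proof.
elim: s F H => [|e s IH] F H; first by rewrite !dexpect_nil addr0.
by rewrite !dexpect_cons !IH !expectD; ring.
Qed.

Lemma dexpectZ s p a F : dexpect s p (fun w => a * F w) = a * dexpect s p F.
Proof.
elim: s F => [|e s IH] F; first by rewrite !dexpect_nil mulr0.
by rewrite !dexpect_cons !IH !expectZ; ring.
Qed.

Lemma chebyshev s p F (A : pred {set T}) x : 0 <= p <= 1 ->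
  (forall w, A w -> (x - expect s p F) ^+ 2 <= (F w - expect s p F) ^+ 2) ->
  expect s p (fun w => (A w)%:R) * (x - expect s p F) ^+ 2 <=
  expect s p (fun w => F w ^+ 2) - expect s p F ^+ 2.
Proof.
move=> p01; set m := expect s p F => AF.
have -> : expect s p (fun w => F w ^+ 2) - m ^+ 2 =
    expect s p (fun w => (F w - m) ^+ 2).
  rewrite (eq_expect s p (F := fun w => (F w - m) ^+ 2)
    (H := fun w => F w ^+ 2 + ((- (2 * m)) * F w + m ^+ 2))); last by move=> w; ring.
  rewrite expectD expectD expectZ expect_cst -/m; ring.
rewrite mulrC -expectZ; apply: le_expect => // w.
case: (boolP (A w)) => [/AF|_]; rewrite ?mulr1 ?mulr0 // sqr_ge0 //.
Qed.

End ProductMeasure.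

(** * Clusters *)

Section Clusters.
Variable G : sgraph.
Local Notation V := (vert G).
Implicit Types (w : {set {set V}}) (x y z u v t : V) (M j : nat).
Local Open Scope nat_scope.

Lemma edgesP (e : {set V}) :
  reflect (exists x y, adj x y /\ e = [set x; y]) (e \in edges G).
Proof.
rewrite inE; apply: (iffP existsP) => [[x /existsP[y /andP[xy /eqP ->]]]|[x [y [xy ->]]]].
  by exists x, y.
by exists x; apply/existsP; exists y; rewrite xy eqxx.
Qed.

Lemma adj_edges x y : adj x y -> [set x; y] \in edges G.
Proof. by move=> xy; apply/edgesP; exists x, y. Qed.

Lemma open_rel_sym w : symmetric (open_rel w).
Proof. by move=> x y; rewrite /open_rel setUC. Qed.

Lemma connectC w : connect_sym (open_rel w).
Proof. exact: sym_connect_sym (@open_rel_sym w). Qed.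

Lemma open_rel_insert w (e : {set V}) x y :
  open_rel w x y -> open_rel (e |: w) x y.
Proof. by rewrite /open_rel !inE => /andP[-> ->]; rewrite orbT. Qed.

Lemma connect_insert w (e : {set V}) x y :
  connect (open_rel w) x y -> connect (open_rel (e |: w)) x y.
Proof. by apply: connect_sub => u v /(open_rel_insert e)/connect1. Qed.

Lemma connect_new_edge w x y : adj x y ->
  connect (open_rel ([set x; y] |: w)) x y.
Proof.
by move=> xy; apply: connect1; rewrite /open_rel in_setI setU11 adj_edges.
Qed.

Definition cluster w x := [set y | connect (open_rel w) x y].

Lemma cluster_refl w x : x \in cluster w x.
Proof. by rewrite inE connect0. Qed.

Lemma cluster_eq w x y : connect (open_rel w) x y -> cluster w x = cluster w y.
Proof. by move=> xy; apply/setP => z; rewrite !inE (same_connect (connectC w) xy). Qed.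

Lemma cluster_insert w (e : {set V}) x : cluster w x \subset cluster (e |: w) x.
Proof. by apply/subsetP => y; rewrite !inE; apply: connect_insert. Qed.

Lemma card_cluster_insert w (e : {set V}) x :
  #|cluster w x| <= #|cluster (e |: w) x|.
Proof. exact/subset_leq_card/cluster_insert. Qed.

Lemma cluster_insert_far w x y z :
  ~~ connect (open_rel w) z x -> ~~ connect (open_rel w) z y ->
  cluster ([set x; y] |: w) z = cluster w z.
Proof.
move=> nzx nzy; apply/eqP; rewrite eqEsubset cluster_insert andbT.
have cl : closed (open_rel ([set x; y] |: w)) (cluster w z).
  apply: (intro_closed (connectC _)) => u v.
  rewrite /open_rel in_setI in_setU1 => /andP[/predU1P[uv|uvw] uvE] zu.
    have: u \in [set x; y] by rewrite -uv set21.
    by move: zu; rewrite !inE => zu /pred2P[] ue; rewrite ue in zu; rewrite zu in nzx nzy.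
  rewrite inE (connect_trans (y := u)) //; first by rewrite inE in zu.
  by apply: connect1; rewrite /open_rel in_setI uvw.
apply/subsetP => u; rewrite inE => zu.
by rewrite -(closed_connect cl zu) cluster_refl.
Qed.

(** * Big vertices and the effect of opening one edge *)

Definition big M w := [set x | M <= #|cluster w x|].

Lemma big_insert M w (e : {set V}) : big M w \subset big M (e |: w).
Proof.
by apply/subsetP => x; rewrite !inE => /leq_trans -> //; apply: card_cluster_insert.
Qed.

Lemma big_connect M w x y : connect (open_rel w) x y ->
  (x \in big M w) = (y \in big M w).
Proof. by move=> /cluster_eq e; rewrite !inE e. Qed.

(** A vertex that becomes big was in the cluster of one of the two endpoints of [e], and that
    cluster had fewer than [M] vertices. *)
Lemma big_increment_le M w (e : {set V}) : e \in edges G ->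
  #|big M (e |: w)| <= #|big M w| + 2 * M.
Proof.
move=> /edgesP[x [y [_ ->]]].
pose small z := if #|cluster w z| < M then cluster w z else set0.
have small_le z : #|small z| <= M.
  by rewrite /small; case: ifP => [/ltnW //|_]; rewrite cards0.
have sub : big M ([set x; y] |: w) \subset big M w :|: (small x :|: small y).
  apply/subsetP => z; rewrite in_setU [z \in big M w]inE.
  case: (leqP M #|cluster w z|) => //= zM.
  case zx: (connect (open_rel w) z x).
    by move=> _; rewrite in_setU /small -(cluster_eq zx) zM cluster_refl.
  case zy: (connect (open_rel w) z y).
    by move=> _; rewrite in_setU /small -(cluster_eq zy) zM cluster_refl orbT.
  by rewrite inE cluster_insert_far ?zx ?zy // leqNgt zM.
apply: leq_trans (subset_leq_card sub) _.
apply: leq_trans (leq_card_setU _ _) _; rewrite leq_add2l.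
apply: leq_trans (leq_card_setU _ _) _.
by rewrite mul2n -addnn leq_add.
Qed.

Lemma big_boundary_increment M w (e : {set V}) :
  e \in edges G ->
  [exists x in big M w, exists y in ~: big M w, e == [set x; y]] ->
  #|big M w| < #|big M (e |: w)|.
Proof.
move=> eE /exists_inP[x xb /exists_inP[y]]; rewrite inE => yb /eqP exy.
apply: proper_card; apply/properP; split; first exact: big_insert.
exists y => //; rewrite inE in xb; rewrite inE.
have xy : connect (open_rel (e |: w)) x y.
  by apply: connect1; rewrite /open_rel -exy in_setI setU11.
by rewrite -(cluster_eq xy); apply: leq_trans xb (card_cluster_insert _ _ _).
Qed.

Lemma boundary_sizeC (A : {set V}) : boundary_size (~: A) = boundary_size A.
Proof.
apply: eq_card => e; rewrite !inE; congr (_ && _).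
apply/exists_inP/exists_inP => -[x xA /exists_inP[y yA /eqP ->]]; exists y.
- by rewrite setCK in yA.
- by apply/exists_inP; exists x; rewrite // setUC.
- by [].
- by apply/exists_inP; exists x; rewrite ?setCK // setUC.
Qed.

(** Each edge leaving the big set creates at least one new big vertex when opened. The subtractions
    are truncated, but the big set only grows. *)
Lemma boundary_le_increments M w :
  boundary_size (big M w) <=
  \sum_(e <- enum (edges G)) (#|big M (e |: w)| - #|big M w|).
Proof.
rewrite /boundary_size -sum1_card big_enum /= big_mkcond [leqRHS]big_mkcond /=.
apply: leq_sum => e _; rewrite inE; case: (boolP (e \in edges G)) => //= eE.
by case: ifP => // h; rewrite subn_gt0 big_boundary_increment.
Qed.

(** * Sum of squared cluster sizes, and merging of two big clusters *)

Definition susceptibility w := \sum_x #|cluster w x|.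

Lemma susceptibility_insert w (e : {set V}) :
  susceptibility w <= susceptibility (e |: w).
Proof. by apply: leq_sum => x _; apply: card_cluster_insert. Qed.

Lemma susceptibility_le w : susceptibility w <= #|V| ^ 2.
Proof.
rewrite expnS expn1 /susceptibility -sum_nat_const.
by apply: leq_sum => x _; apply: max_card.
Qed.

Definition separated M w x y :=
  [&& x \in big M w, y \in big M w & ~~ connect (open_rel w) x y].

(** Each of the at least [M] vertices in the cluster of [x] gains the whole cluster of [y], which is
    disjoint from its own and has at least [M] vertices. *)
Lemma susceptibility_merge M w x y : adj x y -> separated M w x y ->
  susceptibility w + M ^ 2 <= susceptibility ([set x; y] |: w).
Proof.
move=> xy /and3P[xM yM nxy]; rewrite /susceptibility.
apply: (@leq_trans (\sum_z (#|cluster w z| + (z \in cluster w x) * M))).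
  rewrite big_split /= leq_add2l -big_distrl /= expnS expn1 leq_mul2r.
  by rewrite -big_mkcond sum1_card; rewrite inE in xM; rewrite xM orbT.
apply: leq_sum => z _; case: (boolP (z \in cluster w x)) => [|_]; last first.
  by rewrite mul0n addn0 card_cluster_insert.
rewrite inE mul1n => xz; rewrite -(cluster_eq xz).
have dis : [disjoint cluster w x & cluster w y].
  apply/pred0P => u /=; rewrite !inE; apply/negP => /andP[xu yu].
  by case/negP: nxy; apply: connect_trans xu _; rewrite connectC.
apply: (@leq_trans #|cluster w x :|: cluster w y|).
  rewrite cardsU disjoint_setI0 // cards0 subn0 leq_add2l.
  by rewrite inE in yM.
apply: subset_leq_card; rewrite -(cluster_eq (connect_insert _ xz)) subUset.
rewrite cluster_insert (cluster_eq (connect_new_edge w xy)).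
exact: cluster_insert.
Qed.

Lemma sum_adj_le (D : {set V} -> nat) :
  \sum_x \sum_(y | adj x y) D [set x; y] <=
  4 * \sum_(e <- enum (edges G)) D e.
Proof.
rewrite big_enum big_distrr /= pair_big_dep /=.
rewrite (partition_big (fun u : V * V => [set u.1; u.2]) [in edges G]) /=; last first.
  by move=> u; apply: adj_edges.
apply: leq_sum => e _.
rewrite (eq_bigr (fun=> D e)) => [|u /andP[_ /eqP -> //]].
rewrite sum_nat_const leq_mul2r; apply/orP; right.
case: (set_0Vmem [set u : V * V | adj u.1 u.2 && ([set u.1; u.2] == e)]) => [E0|[u0]].
  rewrite (eq_card (B := set0)) ?cards0 // => u.
  by rewrite -E0 inE.
rewrite inE => /andP[_ /eqP e0].
have ce : #|e| <= 2 by rewrite -e0 cards2; case: eqP.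
apply: (@leq_trans #|setX e e|).
  apply: subset_leq_card; apply/subsetP => -[x y] /=; rewrite unfold_in /= => /andP[_ /eqP <-].
  by rewrite !inE !eqxx orbT.
by rewrite cardsX; apply: (leq_mul ce ce).
Qed.

(** * Distance in [G] itself, and vertices near a second big cluster *)

Fixpoint near j x y : bool :=
  if j is j'.+1 then (x == y) || [exists t, adj x t && near j' t y] else x == y.

Lemma near0 j x : near j x x.
Proof. by case: j => [|j] /=; rewrite eqxx. Qed.

Lemma near_le i j x y : i <= j -> near i x y -> near j x y.
Proof.
elim: i j x => [|i IH] j x; first by move=> _ /eqP ->; apply: near0.
case: j => // j ij /= /orP[-> //|/existsP[t /andP[xt ty]]].
by apply/orP; right; apply/existsP; exists t; rewrite xt (IH j).
Qed.

Lemma near_trans i j x y z : near i x y -> near j y z -> near (i + j) x z.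
Proof.
elim: i x => [|i IH] x; first by move=> /eqP ->.
move=> /orP[/eqP -> yz|/existsP[t /andP[xt ty]] yz].
  by apply: near_le yz; rewrite leq_addl.
by rewrite addSn /=; apply/orP; right; apply/existsP; exists t; rewrite xt IH.
Qed.

Lemma near_rcons j x y z : near j x y -> adj y z -> near j.+1 x z.
Proof.
move=> xy yz; rewrite -addn1; apply: near_trans xy _ => /=.
by apply/orP; right; apply/existsP; exists z; rewrite yz eqxx.
Qed.

Lemma near_sym j x y : near j x y -> near j y x.
Proof.
elim: j x y => [|j IH] x y; first by move=> /eqP ->; apply: near0.
move=> /orP[/eqP ->|/existsP[t /andP[xt ty]]]; first exact: near0.
by apply: near_rcons (IH _ _ ty) _; rewrite adj_sym.
Qed.

Definition near_other M j w x := [exists y, separated M w x y && near j x y].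

Lemma near_other0 M w x : near_other M 0 w x = false.
Proof.
apply/negbTE/existsPn => y; rewrite negb_and /=.
by case: (x =P y) => [->|]; rewrite ?orbT // /separated connect0 !andbF.
Qed.

(* Follow the first edge {x, t} of a short path to another big cluster: either
   t already lies in that cluster, or opening {x, t} puts t in the cluster of x
   and the path has become shorter. *)
Lemma near_other_step M j w x : near_other M j.+1 w x ->
  exists2 t, adj x t & separated M w x t || near_other M j ([set x; t] |: w) t.
Proof.
case/existsP => y /andP[/and3P[xb yb nxy]] /= /orP[/eqP xy|].
  by rewrite xy connect0 in nxy.
case/existsP => t /andP[xt ty]; exists t => //.
case: (boolP (connect (open_rel w) y t)) => [yt|nyt].
  apply/orP; left; rewrite /separated xb -(big_connect M yt) yb.
  by apply: contra nxy => cxt; rewrite (connect_trans cxt) // connectC.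
apply/orP; right; apply/existsP; exists y; rewrite ty andbT.
have ncl : cluster ([set x; t] |: w) y = cluster w y.
  by apply: cluster_insert_far; rewrite // connectC.
apply/and3P; split.
- rewrite -(big_connect M (connect_new_edge w xt)).
  exact: subsetP (big_insert _ _ _) _ xb.
- exact: subsetP (big_insert _ _ _) _ yb.
- rewrite connectC; apply: contra nyt => yt.
  have : t \in cluster ([set x; t] |: w) y by rewrite inE.
  by rewrite ncl inE.
Qed.

(** * Degree bounds and balls *)

Lemma card_incident_le d (B : {set V}) : maxdeg_le G d ->
  #|[set e in edges G | [exists y in B, y \in e]]| <= d * #|B|.
Proof.
move=> deg.
pose P := [set u : V * V | (u.1 \in B) && adj u.1 u.2].
apply: (@leq_trans #|P|).
  apply: leq_trans (leq_imset_card (fun u : V * V => [set u.1; u.2]) P).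
  apply: subset_leq_card; apply/subsetP => e.
  rewrite inE => /andP[/edgesP[x [y [xy ->]]] /exists_inP[z zB]].
  rewrite !inE => /pred2P[] ze; rewrite ze in zB; apply/imsetP.
    by exists (x, y); rewrite ?inE ?zB.
  by exists (y, x); rewrite ?inE ?zB 1?adj_sym //= setUC.
have -> : #|P| = \sum_(y in B) degree y.
  rewrite -sum1_card (eq_bigl (fun u : V * V => (u.1 \in B) && adj u.1 u.2)); last first.
    by move=> u; rewrite inE.
  rewrite -(pair_big_dep (mem B) (fun x y => adj x y) (fun _ _ => 1)) /=.
  apply: eq_bigr => x _; rewrite /degree -sum1_card; apply: eq_bigl => y.
  by rewrite inE.
by rewrite mulnC -sum_nat_const; apply: leq_sum => y _; apply: deg.
Qed.

Lemma card_edges_le d : maxdeg_le G d -> #|edges G| <= d * #|V|.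
Proof.
move=> deg; rewrite -cardsT; apply: leq_trans (card_incident_le setT deg).
apply: subset_leq_card; apply/subsetP => e eE; rewrite inE eE.
case/edgesP: eE => x [y [_ ->]]; apply/exists_inP; exists x; rewrite ?inE ?eqxx //.
Qed.

Lemma boundary_le d (S S' : {set V}) : maxdeg_le G d ->
  (forall x y, x \in S -> adj x y -> y \in S') ->
  boundary_size S <= d * #|S' :\: S|.
Proof.
move=> deg SS'; apply: leq_trans (card_incident_le (S' :\: S) deg).
apply: subset_leq_card; apply/subsetP => e; rewrite !inE => /andP[eE].
rewrite eE /= => /exists_inP[x xS /exists_inP[y]]; rewrite inE => yS /eqP exy.
apply/exists_inP; exists y; last by rewrite exy set22.
rewrite inE yS (SS' x) //.
have: e \in edges G by rewrite inE.
case/edgesP => u [v [uv exy']].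
have /set2P : x \in [set u; v] by rewrite -exy' exy set21.
have /set2P : y \in [set u; v] by rewrite -exy' exy set22.
have yx : y <> x by move=> yx; rewrite yx xS in yS.
case=> [yu|yv] [xu|xv]; first by case: yx; rewrite yu.
- by rewrite xv yu adj_sym.
- by rewrite xu yv.
- by case: yx; rewrite yv.
Qed.

Definition ball j (S : {set V}) := [set y | [exists x in S, near j x y]].

Lemma ball_sub j (S : {set V}) : ball j S \subset ball j.+1 S.
Proof.
apply/subsetP => y; rewrite !inE => /exists_inP[x xS xy].
by apply/exists_inP; exists x => //; apply: near_le xy.
Qed.

Lemma sub_ball j (S : {set V}) : S \subset ball j S.
Proof.
by apply/subsetP => x xS; rewrite inE; apply/exists_inP; exists x; rewrite ?near0.
Qed.

(** * Comparison of the largest cluster with the big set *)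

Lemma largest_cluster_attained w : 0 < largest_cluster w ->
  exists x, largest_cluster w = #|cluster w x|.
Proof.
move=> L0; have [|x _ Lx] := @eq_bigmax_cond V predT (fun x => #|cluster w x|).
  rewrite lt0n; apply: contraTneq L0 => V0; rewrite -leqNgt.
  by apply/bigmax_leqP => x _; rewrite leqNgt; have := card0_eq V0 x.
by exists x.
Qed.

Lemma largest_cluster_insert w (e : {set V}) :
  largest_cluster w <= largest_cluster (e |: w).
Proof.
apply/bigmax_leqP => x _; apply: leq_trans (leq_bigmax x).
exact: card_cluster_insert.
Qed.

Lemma largest_le_big M w : M <= largest_cluster w ->
  largest_cluster w <= #|big M w|.
Proof.
case: (posnP (largest_cluster w)) => [-> //|/largest_cluster_attained[x ->] xM].
apply: subset_leq_card; apply/subsetP => y; rewrite inE => xy.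
by rewrite -(big_connect M xy) inE.
Qed.

(** With no separated pair all big vertices share one cluster. Together with [largest_le_big] this
    gives equality once the largest cluster reaches size [M]. *)
Lemma big_le_largest M w : (forall x y, ~~ separated M w x y) ->
  #|big M w| <= largest_cluster w.
Proof.
move=> nsep; case: (set_0Vmem (big M w)) => [->|[x xb]]; first by rewrite cards0.
apply: leq_trans (leq_bigmax x); apply: subset_leq_card; apply/subsetP => y yb.
by have := nsep x y; rewrite /separated xb yb inE /= negbK.
Qed.

(** In a cluster of at least two vertices each vertex is an endpoint of an open edge, and an edge
    covers at most two vertices. *)
Lemma largest_cluster_le_open w : 1 < largest_cluster w ->
  largest_cluster w <= 2 * #|w|.
Proof.
move=> L1; have [x Lx] := largest_cluster_attained (ltnW L1).
have sub : cluster w x \subset cover (w :&: edges G).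
  apply/subsetP => y yx.
  have [z zx zy] : exists2 z, z \in cluster w x & z != y.
    rewrite Lx (cardsD1 y) yx in L1.
    have /card_gt0P[z] : 0 < #|cluster w x :\ y| by rewrite -ltnS.
    by rewrite in_setD1 => /andP[zy zx]; exists z.
  have : connect (open_rel w) y z.
    rewrite !inE in yx zx; apply: connect_trans zx; by rewrite connectC.
  case/connectP => -[|t q] /=.
    by move=> _ ezy; rewrite ezy eqxx in zy.
  move=> /andP[yt _] _; apply/bigcupP; exists [set y; t] => //.
  by rewrite set21.
rewrite Lx; apply: leq_trans (subset_leq_card sub) _.
apply: leq_trans (leq_card_cover _) _.
apply: (@leq_trans (\sum_(e in w :&: edges G) 2)).
  apply: leq_sum => e; rewrite in_setI => /andP[_ /edgesP[u [v [_ ->]]]].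
  by rewrite cards2; case: eqP.
by rewrite sum_nat_const mulnC leq_mul2l /= subset_leq_card // subsetIl.
Qed.

End Clusters.

(** * Expansion and uniqueness of the giant cluster *)

Section Expansion.
Variables (R : realType) (G : sgraph) (b : R) (d : nat).
Hypotheses (b0 : 0 < b) (d0 : (0 < d)%N).
Hypotheses (deg : maxdeg_le G d) (che : cheeger_gt G b).
Local Notation V := (vert G).
Local Notation N := #|V|.

(** As long as the ball fills at most half of the graph, its boundary has more than [b * #|A|]
    edges; each new vertex of the next ball absorbs at most [d] of them, so every step adds at least
    [b * #|A| / d] vertices. *)
Lemma ball_growth j (A : {set V}) : (0 < #|A|)%N ->
  (N < #|ball j A| * 2)%N \/ #|A|%:R * (d%:R + j%:R * b) <= d%:R * #|ball j A|%:R.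
Proof.
move=> A0; elim: j => [|j IH].
  right; rewrite mul0r addr0 mulrC ler_wpM2l ?ler0n // ler_nat.
  exact/subset_leq_card/sub_ball.
have sub := subset_leq_card (ball_sub j A).
have A_le := subset_leq_card (sub_ball j A).
case: IH => [IH|IH]; first by left; lia.
case: (leqP (#|ball j A| * 2) N) => [small|?]; last by left; lia.
right; have := che (leq_trans A0 A_le) small.
rewrite ltr_pdivlMr ?ltr0n ?(leq_trans A0 A_le) // => bnd.
have : (boundary_size (ball j A) <= d * #|ball j.+1 A :\: ball j A|)%N.
  apply: boundary_le => // x y; rewrite !inE => /exists_inP[z zA zx] xy.
  by apply/exists_inP; exists z => //; apply: near_rcons zx xy.
rewrite cardsD (setIidPr (ball_sub j A)) => bnd2.
have {bnd2} : (boundary_size (ball j A))%:R <=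
    d%:R * (#|ball j.+1 A|%:R - #|ball j A|%:R) :> R.
  by rewrite -natrB // -natrM ler_nat.
have : b * #|A|%:R <= b * #|ball j A|%:R by rewrite (ler_wpM2l (ltW b0)) // ler_nat.
rewrite -natr1; lra.
Qed.

(** Otherwise, removing the vertices near another big cluster leaves more than [M / 2] vertices of
    each of the clusters of [x] and [y]. By linear growth, and by the choice of [r], the [r]-balls
    around both remainders exceed half of the graph, so they meet; this gives a path of length at
    most [r + r] from a vertex supposed to have none. *)
Lemma many_near_other M r (w : {set {set V}}) x y : (0 < M)%N ->
  (d * N)%:R <= M%:R * r%:R * b -> separated M w x y ->
  (M <= 2 * #|[set z | near_other M (r + r) w z]|)%N.
Proof.
move=> M0 MN sep; rewrite leqNgt; apply/negP => Tsmall.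
set T := [set z | near_other M (r + r) w z] in Tsmall.
have large u : u \in big M w ->
    (0 < #|cluster w u :\: T|)%N /\ (N < #|ball r (cluster w u :\: T)| * 2)%N.
  rewrite inE => uM; have := cardsID T (cluster w u).
  have := subset_leq_card (subsetIr (cluster w u) T) => h1 h2.
  have A0 : (0 < #|cluster w u :\: T|)%N by lia.
  split => //; case: (ball_growth r A0) => // gr.
  case: (leqP (#|ball r (cluster w u :\: T)| * 2) N) => // small.
  have : (M%:R : R) <= 2 * #|cluster w u :\: T|%:R by rewrite -natrM ler_nat; lia.
  have : (#|ball r (cluster w u :\: T)|%:R * 2 : R) <= N%:R by rewrite -natrM ler_nat.
  move: (A0) MN d0; rewrite -(ltr_nat R) -[(0 < d)%N](ltr_nat R) natrM.
  move: gr; set a := #|cluster w u :\: T|%:R; set c := #|ball _ _|%:R => gr a0 MN d0' cN Ma.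
  have : d%:R * (c * 2) <= d%:R * N%:R by rewrite ler_wpM2l // ltW.
  have : M%:R * (r%:R * b) <= 2 * a * (r%:R * b) by rewrite ler_wpM2r // mulr_ge0 // ltW.
  have : 0 < a * d%:R by rewrite mulr_gt0.
  lra.
have /and3P[xb yb nxy] := sep.
have [_ bx] := large _ xb; have [_ by'] := large _ yb.
have : (0 < #|ball r (cluster w x :\: T) :&: ball r (cluster w y :\: T)|)%N.
  have := cardsUI (ball r (cluster w x :\: T)) (ball r (cluster w y :\: T)).
  have := subset_leq_card (subsetT (ball r (cluster w x :\: T) :|: ball r (cluster w y :\: T))).
  rewrite cardsT.
  lia.
case/card_gt0P => z; rewrite !inE => /andP[/exists_inP[x' x'A x'z] /exists_inP[y' y'A y'z]].
move: x'A y'A; rewrite !inE => /andP[/negP nx' xx'] /andP[_ yy'].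
apply: nx'; apply/existsP; exists y'.
rewrite (near_trans x'z (near_sym y'z)) andbT /separated.
rewrite -(big_connect M xx') -(big_connect M yy') xb yb /=.
apply: contra nxy => x'y'; apply: connect_trans (connect_trans xx' x'y') _.
by rewrite connectC.
Qed.

(** The product form treats [A] and its complement alike, so it holds for every size, and its mean
    over a random [A] involves only the first two moments of [#|A|]. *)
Lemma cheeger_mul (A : {set V}) :
  b * (#|A|%:R * (N%:R - #|A|%:R)) <= N%:R * (boundary_size A)%:R.
Proof.
clear d0 deg d; have key (B : {set V}) : (#|B| * 2 <= N)%N ->
    b * (#|B|%:R * (N%:R - #|B|%:R)) <= N%:R * (boundary_size B)%:R.
  move=> Bs; case: (posnP #|B|) => [->|B0]; first by rewrite mul0r mulr0 mulr_ge0.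
  have := che B0 Bs; rewrite ltr_pdivlMr ?ltr0n // => /ltW bnd.
  have : N%:R * (b * #|B|%:R) <= N%:R * (boundary_size B)%:R by rewrite ler_wpM2l.
  have : 0 <= b * (#|B|%:R * #|B|%:R) by rewrite mulr_ge0 ?mulr_ge0 // ltW.
  lra.
case: (leqP (#|A| * 2) N) => [/key //|As].
have := key (~: A); rewrite boundary_sizeC.
have <- : (#|A| + #|~: A|)%N = N by rewrite cardsC.
rewrite natrD => h; apply: le_trans (h _); last by have := cardsC A; lia.
by rewrite le_eqVlt; apply/orP; left; apply/eqP; ring.
Qed.

(** * Differential inequalities in [p] *)

Section Percolation.
Variable M : nat.
Local Notation s := (enum (edges G)).
Local Notation g := (fun w : {set {set V}} => #|big M w|%:R : R).
Local Notation chi := (fun w : {set {set V}} => (susceptibility w)%:R : R).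
Local Notation sep x y := (fun w : {set {set V}} => (separated M w x y)%:R : R).
Local Notation other j x := (fun w : {set {set V}} => (near_other M j w x)%:R : R).
Local Notation multi :=
  (fun w : {set {set V}} => [exists x, exists y, separated M w x y]%:R : R).

Lemma card_big_nondecr : nondecr_on s g.
Proof. by move=> e w _; rewrite ler_nat subset_leq_card // big_insert. Qed.

Lemma susceptibility_nondecr : nondecr_on s chi.
Proof. by move=> e w _; rewrite ler_nat susceptibility_insert. Qed.

Lemma russo_le p (F : {set {set V}} -> R) : 0 <= p <= 1 -> nondecr_on s F ->
  expect s p (fun w => \sum_(e <- s) (F (e |: w) - F w)) <= dexpect s p F.
Proof.
move=> p01 mF; rewrite -russo ler_piMl ?dexpect_ge0 //; lra.
Qed.

Lemma var_card_big_le p : 0 <= p <= 1 ->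
  expect s p (fun w => g w ^+ 2) - expect s p g ^+ 2 <=
  (2 * M)%:R * dexpect s p g.
Proof.
move=> p01; apply: efron_stein => //; first exact: card_big_nondecr.
move=> e w; rewrite mem_enum => eE.
by rewrite lerBlDl -natrD ler_nat big_increment_le.
Qed.

Lemma expansion_card_big_le p : 0 <= p <= 1 ->
  b * expect s p (fun w => g w * (N%:R - g w)) <= N%:R * dexpect s p g.
Proof.
move=> p01; rewrite -expectZ.
apply: le_trans (ler_wpM2l (ler0n _ _) (russo_le p01 card_big_nondecr)).
rewrite -expectZ; apply: le_expect => // w.
apply: le_trans (cheeger_mul _) _; rewrite ler_wpM2l //.
apply: (@le_trans _ _ (\sum_(e <- s) (#|big M (e |: w)| - #|big M w|)%N%:R)).
  by rewrite -natr_sum ler_nat boundary_le_increments.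
apply: ler_sum => e _; rewrite natrB //; exact/subset_leq_card/big_insert.
Qed.

(** Opening an edge between separated vertices raises the susceptibility by at least [M ^ 2];
    Russo's formula sums these gains, and the 4 bounds the number of ordered pairs per edge. *)
Lemma merge_rate_le p : 0 <= p <= 1 ->
  (M ^ 2)%:R * \sum_x \sum_(y | adj x y) expect s p (sep x y) <=
  4 * dexpect s p chi.
Proof.
move=> p01.
apply: le_trans (ler_wpM2l (ler0n _ 4) (russo_le p01 susceptibility_nondecr)).
under eq_bigr => x _ do rewrite -expect_sum.
rewrite -expect_sum -!expectZ; apply: le_expect => // w.
apply: (@le_trans _ _
  (\sum_x \sum_(y | adj x y) (susceptibility ([set x; y] |: w) - susceptibility w)%N)%:R).
  rewrite natr_sum mulr_sumr; apply: ler_sum => x _.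
  rewrite natr_sum mulr_sumr; apply: ler_sum => y xy.
  rewrite -natrM ler_nat; case: (boolP (separated M w x y)) => [sxy|_]; last by rewrite muln0.
  by have := susceptibility_merge xy sxy; lia.
apply: (@le_trans _ _ (4 * \sum_(e <- s) (susceptibility (e |: w) - susceptibility w)%N)%N%:R).
  by rewrite ler_nat (sum_adj_le (fun e => susceptibility (e |: w) - susceptibility w)%N).
rewrite natrM ler_wpM2l // natr_sum; apply: ler_sum => e _.
by rewrite natrB // susceptibility_insert.
Qed.

(** With [E j] the left-hand sum and [Y] the sum over adjacent separated pairs, following the first
    edge of the path gives [E (j+1) <= Y + (d / p) * E j]: forcing that edge open costs [1 / p], and
    each vertex is reached from at most [d] neighbours. The factor 2 in [2 * d / p] absorbs the
    added [Y]. *)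
Lemma near_other_expect_le p j : 0 < p <= 1 ->
  \sum_x expect s p (other j x) <=
  (2 * d%:R / p) ^+ j * \sum_x \sum_(y | adj x y) expect s p (sep x y).
Proof.
move=> /andP[p0 p1]; have p01 : 0 <= p <= 1 by rewrite ltW.
have d1 : 1 <= d%:R :> R by rewrite ler1n.
set Y := \sum_x \sum_(y | adj x y) _.
have Y0 : 0 <= Y by apply: sumr_ge0 => x _; apply: sumr_ge0 => y _; apply: expect_ge0.
set a := 2 * d%:R / p.
have a2 : 2 <= a by rewrite /a ler_pdivlMr //; nra.
elim: j => [|j IH].
  rewrite expr0 mul1r big1 // => x _.
  rewrite -[RHS](expect_cst s p 0); apply: eq_expect => w.
  by rewrite near_other0.
have step x : expect s p (other j.+1 x) <=
    \sum_(t | adj x t) (expect s p (sep x t) + p^-1 * expect s p (other j t)).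
  apply: (@le_trans _ _ (expect s p (fun w => \sum_(t | adj x t)
     ((separated M w x t)%:R + (near_other M j ([set x; t] |: w) t)%:R)))).
    apply: le_expect => // w; case: (boolP (near_other M j.+1 w x)) => [|_]; last first.
      by apply: sumr_ge0 => t _; rewrite addr_ge0.
    case/near_other_step => t xt st; rewrite (bigD1 t) //=.
    apply: (@le_trans _ _ ((separated M w x t)%:R + (near_other M j ([set x; t] |: w) t)%:R)).
      by rewrite -natrD ler_nat addn_gt0 !lt0b.
    by rewrite lerDl sumr_ge0 // => u _; rewrite addr_ge0.
  rewrite expect_sum; apply: ler_sum => t xt; rewrite expectD lerD2l.
  rewrite mulrC ler_pdivlMr // mulrC.
  apply: (expect_insert (F := other j t)) => //.
  by rewrite mem_enum adj_edges.
apply: le_trans (ler_sum _ (fun x _ => step x)) _.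
under eq_bigr => x _ do rewrite big_split /=.
rewrite big_split /= -/Y.
have -> : \sum_x \sum_(t | adj x t) p^-1 * expect s p (other j t) =
    \sum_t (degree t)%:R * (p^-1 * expect s p (other j t)).
  rewrite (exchange_big_dep predT) //=; apply: eq_bigr => t _.
  rewrite sumr_const [RHS]mulr_natl; congr (_ *+ _); rewrite /degree.
  by apply: eq_card => x; rewrite !inE adj_sym.
have : \sum_t (degree t)%:R * (p^-1 * expect s p (other j t)) <=
    d%:R / p * \sum_t expect s p (other j t).
  rewrite mulr_sumr; apply: ler_sum => t _; rewrite mulrA ler_wpM2r ?expect_ge0 //.
  by rewrite ler_wpM2r ?invr_ge0 ?(ltW p0) // ler_nat deg.
have -> : d%:R / p = a / 2 by rewrite /a; field; rewrite gt_eqF.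
have : a / 2 * (\sum_t expect s p (other j t)) <= a / 2 * (a ^+ j * Y).
  by rewrite ler_wpM2l // divr_ge0 //; lra.
have : 2 * Y <= a ^+ j.+1 * Y.
  rewrite ler_wpM2r // exprS.
  have : 1 <= a ^+ j by rewrite exprn_ege1 //; lra.
  nra.
rewrite exprS; lra.
Qed.

(** Two separated big clusters force at least [M / 2] vertices near another big cluster; these are
    paid for by separated edges, and those by the derivative of the susceptibility. *)
Lemma several_big_le p r : 0 < p <= 1 -> (0 < M)%N ->
  (d * N)%:R <= M%:R * r%:R * b ->
  (M ^ 3)%:R * expect s p multi <=
  8 * (2 * d%:R / p) ^+ (r + r) * dexpect s p chi.
Proof.
move=> p01' M0 MN; have p01 : 0 <= p <= 1 by case/andP: p01' => /ltW -> ->.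
have h1 : M%:R * expect s p multi <= 2 * \sum_x expect s p (other (r + r) x).
  rewrite -expect_sum -!expectZ; apply: le_expect => // w.
  case: (boolP [exists x, exists y, separated M w x y]) => [|_]; last first.
    by rewrite mulr0 mulr_ge0 // sumr_ge0.
  case/existsP => x /existsP[y sxy]; rewrite mulr1 -natr_sum -natrM ler_nat.
  apply: leq_trans (many_near_other M0 MN sxy) _.
  rewrite leq_mul2l /= -sum1_card big_mkcond /=; apply: leq_sum => z _.
  by rewrite inE; case: near_other.
have h2 := near_other_expect_le (r + r) p01'.
have h3 := merge_rate_le p01.
rewrite expnSr natrM -mulrA.
apply: le_trans (ler_wpM2l (ler0n R (M ^ 2)) h1) _.
set a := _ ^+ (r + r) in h2 *; set Y := \sum_x \sum_(y | adj x y) _ in h2 h3.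
have a0 : 0 <= a.
  by rewrite exprn_ge0 // divr_ge0 ?mulr_ge0 //; case/andP: p01.
have : 2 * (M ^ 2)%:R * (\sum_x expect s p (other (r + r) x)) <= 2 * (M ^ 2)%:R * (a * Y).
  by rewrite ler_wpM2l // mulr_ge0.
have : 2 * a * ((M ^ 2)%:R * Y) <= 2 * a * (4 * dexpect s p chi).
  by rewrite ler_wpM2l // mulr_ge0.
lra.
Qed.

End Percolation.
End Expansion.

(** * The width of the threshold window *)

Section Giant.
Variables (R : realType) (G : sgraph) (c : R).
Local Notation V := (vert G).
Local Notation N := #|V|.
Local Notation s := (enum (edges G)).

Definition giant (w : {set {set V}}) := c * N%:R <= (largest_cluster w)%:R.

Lemma prob_giantE p : prob_giant G p c = expect s p (fun w => (giant w)%:R).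
Proof.
rewrite expectE ?enum_uniq // set_enum /prob_giant big_mkcondr /=.
by apply: eq_bigr => w _; rewrite /giant; case: ifP; rewrite ?mul1r ?mul0r.
Qed.

Lemma giant_nondecr : nondecr_on s (fun w => (giant w)%:R : R).
Proof.
move=> e w _; rewrite ler_nat; have: giant w -> giant (e |: w).
  by move=> /le_trans; apply; rewrite ler_nat largest_cluster_insert.
by case: giant => // ->.
Qed.

(** Markov's inequality for the number of open edges. The condition [1 < c * N] rules out a giant
    cluster of a single vertex, which has no open edge. *)
Lemma prob_giant_le d (p : R) : maxdeg_le G d -> 0 <= p <= 1 -> 1 < c * N%:R ->
  prob_giant G p c * (c * N%:R) <= 2 * p * (d * N)%:R.
Proof.
move=> deg p01 cN; have [p0 _] := andP p01.
apply: (@le_trans _ _ (2 * (p * (size s)%:R))); last first.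
  by rewrite -!mulrA !ler_wpM2l // ler_nat -cardE card_edges_le.
apply: le_trans (ler_wpM2l _ (expect_card_le s p01)); last by [].
rewrite prob_giantE mulrC -!expectZ; apply: le_expect => // w.
case: (boolP (giant w)) => gw; last by rewrite mulr0 mulr_ge0.
have L1 := lt_le_trans cN gw; rewrite mulr1 -natrM.
apply: le_trans gw _; rewrite ler_nat.
by apply: largest_cluster_le_open; rewrite -(ltr_nat R).
Qed.

End Giant.

Lemma sqr_dist_le (R : realDomainType) (h c x : R) :
  h <= c -> c <= x -> (c - h) ^+ 2 <= (x - h) ^+ 2.
Proof. by move=> hc cx; apply: lerXn2r; rewrite ?nnegrE; lra. Qed.

Lemma sqr_dist_ge (R : realDomainType) (h c x : R) :
  c <= h -> x <= c -> (h - c) ^+ 2 <= (h - x) ^+ 2.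
Proof. by move=> hc cx; apply: lerXn2r; rewrite ?nnegrE; lra. Qed.

(** Here [y] bounds the squared amount by which [h1] may fall below [c] or [h2] exceed it. If [y]
    reaches [m ^ 2] or [(k * w / 4) ^ 2], its definition gives the claim through the first or the
    second constant. Otherwise [m <= h1], [h2 <= 1 - m] and [h2 - h1 < k * w / 2], against the
    growth hypothesis. *)
Lemma window_arith (R : realFieldType) (alpha b m e w c h1 h2 y k : R) :
  0 < b -> 0 < m -> 0 < alpha -> 0 < w -> w <= 1 -> 0 <= e ->
  2 * m <= c -> 2 * m <= 1 - c ->
  y = 32 * e / (alpha * w) -> k = b * m ^+ 2 / (1 + 2 * b) ->
  (h1 <= c -> (c - h1) ^+ 2 <= y) -> (c <= h2 -> (c - h2) ^+ 2 <= y) ->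
  (m <= h1 -> h2 <= 1 - m -> k * (w / 2) <= h2 - h1) ->
  w ^+ 3 <= (32 / (m ^+ 2 * alpha) + 512 / (alpha * k ^+ 2)) * e.
Proof.
move=> b0 m0 al0 w0 w1 e0 mc m1c yE kE Hh1 Hh2 gr.
have k0 : 0 < k by rewrite kE divr_gt0 ?mulr_gt0 ?exprn_gt0 //; lra.
have yw : y * (alpha * w) = 32 * e by rewrite yE mulfVK // gt_eqF ?mulr_gt0.
have w2 : w ^+ 2 <= 1 by rewrite expr_le1 // ltW.
have w3 : w ^+ 3 <= w by rewrite exprS ler_piMr // ltW.
set C1 := 32 / _; set C2 := 512 / _.
have C1e : C1 * e = y * w / m ^+ 2.
  rewrite /C1 yE; field; rewrite !gt_eqF //.
have C2e : C2 * e = 16 * (y * w / k ^+ 2).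
  rewrite /C2 yE; field; rewrite !gt_eqF //.
have C10 : 0 <= C1 * e by rewrite mulr_ge0 // divr_ge0 // ltW // mulr_gt0 ?exprn_gt0.
have C20 : 0 <= C2 * e by rewrite mulr_ge0 // divr_ge0 // ltW // mulr_gt0 ?exprn_gt0.
rewrite mulrDl.
have [ym|ym] := leP (m ^+ 2) y.
  have : w <= C1 * e by rewrite C1e ler_pdivlMr ?exprn_gt0 // mulrC ler_wpM2r // ltW.
  lra.
have [yk|yk] := leP ((k * w / 4) ^+ 2) y.
  have : w ^+ 3 <= C2 * e.
    rewrite C2e !mulrA ler_pdivlMr ?exprn_gt0 //.
    have := ler_wpM2l (ltW w0) yk; lra.
  lra.
have near_c t : t ^+ 2 <= y -> t < m /\ t < k * w / 4.
  have kw0 : 0 < k * w / 4 by rewrite divr_gt0 // mulr_gt0.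
  by move=> ty; split; nra.
have [h1c h1k] : h1 > c - m /\ h1 > c - k * w / 4.
  have kw0 : 0 < k * w / 4 by rewrite divr_gt0 // mulr_gt0.
  have [/Hh1/near_c[] |] := leP h1 c; lra.
have [h2c h2k] : h2 < c + m /\ h2 < c + k * w / 4.
  have kw0 : 0 < k * w / 4 by rewrite divr_gt0 // mulr_gt0.
  have [/Hh2 |] := leP c h2; last by lra.
  rewrite -sqrrN opprB => /near_c[]; lra.
have h1m : m <= h1 by lra.
have h2m : h2 <= 1 - m by lra.
have := gr h1m h2m; lra.
Qed.

(** * Analysis of one threshold window *)

Section Window.
Variables (R : realType) (G : sgraph) (b c alpha : R) (d M r : nat) (p1 p2 : R).
Local Notation V := (vert G).
Local Notation N := (#|V|%:R : R).
Local Notation s := (enum (edges G)).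
Hypotheses (b0 : 0 < b) (d0 : (0 < d)%N) (al : 0 < alpha < 2^-1).
Hypotheses (deg : maxdeg_le G d) (che : cheeger_gt G b).
Hypotheses (M0 : (0 < M)%N) (MN : (d * #|V|)%:R <= M%:R * r%:R * b).
Hypotheses (c01 : 0 < c < 1) (Mc : M%:R <= c * N) (N0 : 0 < N).
Hypotheses (p1_gt0 : 0 < p1) (p12 : p1 < p2) (p2_le1 : p2 <= 1).
Hypotheses (f1 : prob_giant G p1 c = alpha) (f2 : prob_giant G p2 c = 1 - alpha).

Let dens (w : {set {set V}}) : R := N^-1 * #|big M w|%:R.
Let susc (w : {set {set V}}) : R := N^-1 ^+ 2 * (susceptibility w)%:R.
Let h p := expect s p dens.
Let h2 p := expect s p (fun w => dens w ^+ 2).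
Let dh p := dexpect s p dens.
Let multi (w : {set {set V}}) : bool := [exists x, exists y, separated M w x y].
(** The factor from [several_big_le] for the normalised susceptibility, taken at the left end [p1],
    where it is largest. *)
Let delta := 8 * (2 * d%:R / p1) ^+ (r + r) * N ^+ 2 / (M ^ 3)%:R.

Lemma dens_nondecr : nondecr_on s dens.
Proof. by move=> e w es; rewrite ler_wpM2l ?invr_ge0 ?ler0n //; apply: card_big_nondecr. Qed.

Lemma susc_nondecr : nondecr_on s susc.
Proof.
move=> e w es; rewrite ler_wpM2l ?exprn_ge0 ?invr_ge0 ?ler0n //.
exact: susceptibility_nondecr.
Qed.

Lemma dens01 w : 0 <= dens w <= 1.
Proof.
rewrite /dens mulr_ge0 ?invr_ge0 ?ler0n //= mulrC ler_pdivrMr // mul1r ler_nat.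
exact: max_card.
Qed.

Lemma susc01 w : 0 <= susc w <= 1.
Proof.
rewrite /susc mulr_ge0 ?exprn_ge0 ?invr_ge0 ?ler0n //= exprVn mulrC.
rewrite ler_pdivrMr ?exprn_gt0 // mul1r -natrX ler_nat.
exact: susceptibility_le.
Qed.

Lemma dens_expectE (p : R) : [/\ h p = N^-1 * expect s p (fun w => #|big M w|%:R),
  h2 p = N^-1 ^+ 2 * expect s p (fun w => #|big M w|%:R ^+ 2) &
  dh p = N^-1 * dexpect s p (fun w => #|big M w|%:R)].
Proof.
split; rewrite -1?dexpectZ -?expectZ //.
by apply: eq_expect => w; rewrite /dens exprMn.
Qed.

Lemma var_dens (p : R) : 0 <= p <= 1 -> h2 p - h p ^+ 2 <= 2 * (M%:R / N) * dh p.
Proof.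
move=> p01; have := @var_card_big_le R G M p p01; rewrite natrM.
case: (dens_expectE p) => -> -> ->.
move/(ler_wpM2l (sqr_ge0 (N^-1 : R))).
set x := expect _ _ _; set x2 := expect _ _ _; set dx := dexpect _ _ _.
set a := N^-1; lra.
Qed.

Lemma growth_dens (p : R) : 0 <= p <= 1 -> b * (h p - h2 p) <= dh p.
Proof.
move=> p01; have := expansion_card_big_le b0 che M p01.
case: (dens_expectE p) => -> -> ->.
have -> : expect s p (fun w => #|big M w|%:R * (N - #|big M w|%:R)) =
    N * expect s p (fun w => #|big M w|%:R) - expect s p (fun w => #|big M w|%:R ^+ 2).
  by rewrite -expectZ -expectB; apply: eq_expect => w; ring.
move/(ler_wpM2l (sqr_ge0 (N^-1 : R))).
set x := expect _ _ _; set x2 := expect _ _ _; set dx := dexpect _ _ _.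
have aN : N^-1 * N = 1 by rewrite mulVf // gt_eqF.
have -> : N^-1 ^+ 2 * (b * (N * x - x2)) = b * ((N^-1 * N) * (N^-1 * x) - N^-1 ^+ 2 * x2) by ring.
have -> : N^-1 ^+ 2 * (N * dx) = (N^-1 * N) * (N^-1 * dx) by ring.
by rewrite aN !mul1r.
Qed.

Lemma several_big_susc (p : R) : p1 <= p <= 1 ->
  expect s p (fun w => (multi w)%:R) <= delta * dexpect s p susc.
Proof.
move=> /andP[p1p ple1]; have p0 : 0 < p by apply: lt_le_trans p1p.
have p01 : 0 < p <= 1 by rewrite p0.
have := several_big_le b0 d0 deg che p01 M0 MN.
rewrite /susc dexpectZ /delta.
have chi0 : 0 <= dexpect s p (fun w => (susceptibility w)%:R).
  by apply: dexpect_ge0; [rewrite ltW | exact: susceptibility_nondecr].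
set X := expect _ _ _; set D := dexpect _ _ _ in chi0 *.
have M3 : 0 < (M ^ 3)%:R :> R by rewrite ltr0n expn_gt0 M0.
have cancel_N (x y : R) : 8 * x * N ^+ 2 / y * (N^-1 ^+ 2 * D) = 8 * x * D / y.
  have NN : N^-1 * N = 1 by rewrite mulVf // gt_eqF.
  transitivity (8 * x * D / y * (N^-1 * N) ^+ 2); first by ring.
  by rewrite NN expr1n mulr1.
move=> H; rewrite cancel_N ler_pdivlMr // mulrC; apply: le_trans H _.
rewrite ler_wpM2r // ler_wpM2l // lerXn2r ?nnegrE ?divr_ge0 ?mulr_ge0 ?(ltW p0) ?(ltW p1_gt0) //.
by rewrite ler_wpM2l ?mulr_ge0 // lef_pV2.
Qed.

(** The mean value theorem is applied to the sum of density and susceptibility, whose mean lies in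
    [[0, 2]]: both derivatives are nonnegative, so a single point bounds both. *)
Lemma slow_point (q1 q2 : R) : 0 <= q1 -> q1 < q2 -> q2 <= 1 ->
  exists2 q, q1 < q < q2 &
    dh q * (q2 - q1) <= 2 /\ dexpect s q susc * (q2 - q1) <= 2.
Proof.
move=> q10 q12 q21.
have [q qin] := expect_mvt s (fun w => dens w + susc w) q12.
have [qa qb] := andP qin; have q01 : 0 <= q <= 1 by lra.
have ub x : 0 <= x <= 1 -> expect s x (fun w => dens w + susc w) <= 2.
  move=> x01; rewrite -(expect_cst s x 2); apply: le_expect => // w.
  by have := dens01 w; have := susc01 w; lra.
have lb x : 0 <= x <= 1 -> 0 <= expect s x (fun w => dens w + susc w).
  move=> x01; apply: expect_ge0 => // w.
  by have := dens01 w; have := susc01 w; lra.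
have a1 : 0 <= dh q by apply: dexpect_ge0 => //; exact: dens_nondecr.
have a2 : 0 <= dexpect s q susc by apply: dexpect_ge0 => //; exact: susc_nondecr.
rewrite dexpectD -/(dh q) => E; exists q => //.
have := ub q2; have := lb q1 => /(_ _) l1 /(_ _) u2.
have {}l1 : 0 <= expect s q1 (fun w => dens w + susc w) by apply: l1; lra.
have {}u2 : expect s q2 (fun w => dens w + susc w) <= 2 by apply: u2; lra.
have : 0 <= dh q * (q2 - q1) by rewrite mulr_ge0 //; lra.
have : 0 <= dexpect s q susc * (q2 - q1) by rewrite mulr_ge0 //; lra.
by split; lra.
Qed.

Lemma dens_ge_giant w : giant c w -> c <= dens w.
Proof.
rewrite /giant /dens => gw; rewrite mulrC ler_pdivlMr //.
have := le_trans Mc gw; rewrite ler_nat => /largest_le_big Lg.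
by apply: le_trans gw _; rewrite ler_nat.
Qed.

Lemma dens_lt_notgiant w : ~~ giant c w -> ~~ multi w -> dens w <= c.
Proof.
rewrite /giant -ltNge /dens => gw nm; rewrite mulrC ler_pdivrMr //.
apply: le_trans _ (ltW gw); rewrite ler_nat; apply: big_le_largest => x y.
by move/existsPn/(_ x)/existsPn: nm; apply.
Qed.

Lemma threshold_le_card : M%:R / N <= 1.
Proof.
have [c0 c1] := andP c01; rewrite ler_pdivrMr // mul1r.
by apply: le_trans Mc _; rewrite ler_piMl // ltW.
Qed.

(** Since [m ^ 2 <= h q * (1 - h q)], split the right side into the mean of [dens * (1 - dens)] and
    the variance: expansion bounds the former by [dh q / b], and the latter is at most [2 * dh q]
    since [M <= N]. *)
Lemma growth_rate (m k q : R) : 0 < m -> k = b * m ^+ 2 / (1 + 2 * b) ->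
  0 <= q <= 1 -> m <= h q -> h q <= 1 - m -> k <= dh q.
Proof.
move=> m0 kE q01 mh hm; have lb0 := b0.
have dh0 : 0 <= dh q by apply: dexpect_ge0 => //; exact: dens_nondecr.
have h_ge : m ^+ 2 <= h q * (1 - h q) by nra.
have g1 := ler_wpM2l (ltW b0) h_ge; have g2 := growth_dens q01.
have g3 := ler_wpM2l (ltW b0) (var_dens q01).
have g4 : M%:R / N * (b * dh q) <= 1 * (b * dh q).
  by rewrite ler_wpM2r ?threshold_le_card // mulr_ge0 // ltW.
by rewrite kE ler_pdivrMr; lra.
Qed.

Lemma prob_giant_between q : p1 <= q <= p2 ->
  alpha <= expect s q (fun w => (giant c w)%:R) <= 1 - alpha.
Proof.
move=> /andP[q1 q2]; rewrite -{1}f1 -f2 !prob_giantE.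
have ge0 := ltW p1_gt0; have le1 := p2_le1.
by rewrite !expect_homo //; try exact: giant_nondecr; lra.
Qed.

Lemma prob_one_big_ge q x : p1 <= q <= p2 -> 0 <= x ->
  dexpect s q susc <= x -> delta * x <= alpha / 2 ->
  alpha / 2 <= expect s q (fun w => (~~ giant c w && ~~ multi w)%:R).
Proof.
move=> q12 x0 sx dx; have /andP[_ f_le] := prob_giant_between q12.
have several : expect s q (fun w => (multi w)%:R) <= alpha / 2.
  have /several_big_susc H : p1 <= q <= 1.
    by case/andP: q12 => -> /le_trans; apply; exact: p2_le1.
  apply: le_trans H (le_trans _ dx); rewrite ler_wpM2l //.
  by rewrite /delta divr_ge0 // !mulr_ge0 ?exprn_ge0 ?divr_ge0 ?mulr_ge0 ?(ltW p1_gt0).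
have q01 : 0 <= q <= 1.
  case/andP: q12 => q1 q2.
  by rewrite (le_trans (ltW p1_gt0) q1) (le_trans q2 p2_le1).
have : 1 <= expect s q (fun w => (giant c w)%:R + ((multi w)%:R +
   (~~ giant c w && ~~ multi w)%:R)).
  rewrite -[X in X <= _](expect_cst s q); apply: le_expect => // w.
  by rewrite -!natrD ler1n; case: (giant c w) (multi w) => [] [].
rewrite !expectD; lra.
Qed.

Lemma dens_deviation q x (P : pred {set {set V}}) : 0 <= q <= 1 -> 0 <= x ->
  2 * (M%:R / N) * dh q <= x -> alpha / 2 <= expect s q (fun w => (P w)%:R) ->
  (forall w, P w -> (c - h q) ^+ 2 <= (dens w - h q) ^+ 2) ->
  (c - h q) ^+ 2 <= 2 * x / alpha.
Proof.
move=> q01 x0 dx Pge Pdev; have [al0 _] := andP al.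
have v1 := chebyshev q01 Pdev; have v2 := var_dens q01.
have v3 := ler_wpM2r (sqr_ge0 (c - h q)) Pge.
rewrite ler_pdivlMr //; move: v1 v2 v3; rewrite -/(h q) -/(h2 q); lra.
Qed.

Lemma window_le (m k : R) :
  0 < m -> 2 * m <= c -> 2 * m <= 1 - c -> k = b * m ^+ 2 / (1 + 2 * b) ->
  16 * delta <= alpha * (p2 - p1) ->
  (p2 - p1) ^+ 3 <= (32 / (m ^+ 2 * alpha) + 512 / (alpha * k ^+ 2)) * (M%:R / N).
Proof.
move=> m0 mc m1c kE; move wE : (p2 - p1) => w small; set e := M%:R / N.
have [lb0 lp1 lp12 lp2] := And4 b0 p1_gt0 p12 p2_le1.
have w0 : 0 < w by lra.
have w1 : w <= 1 by lra.
have [al0 al1] := andP al.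
have e0 : 0 <= e by rewrite divr_ge0 // ltW.
(* Slow points are taken in the first and last quarters of the window, so that they are at least
   [w / 2] apart. *)
have [|||q1 /andP[q1a q1b] [dh1 _]] := @slow_point p1 (p1 + w / 4); [lra..|].
have [|||q2 /andP[q2a q2b] [dh2 ds2]] := @slow_point (p2 - w / 4) p2; [lra..|].
have q101 : 0 <= q1 <= 1 by lra.
have q201 : 0 <= q2 <= 1 by lra.
have dq1 : dh q1 <= 8 / w by rewrite ler_pdivlMr //; lra.
have dq2 : dh q2 <= 8 / w by rewrite ler_pdivlMr //; lra.
have dsq2 : dexpect s q2 susc <= 8 / w by rewrite ler_pdivlMr //; lra.
have w8 : 0 <= 8 / w by rewrite divr_ge0 // ltW.
have x0 : 0 <= 2 * e * (8 / w) by rewrite mulr_ge0 // mulr_ge0.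
have yE : 32 * e / (alpha * w) = 2 * (2 * e * (8 / w)) / alpha.
  by field; rewrite !gt_eqF.
have q1_in : p1 <= q1 <= p2 by lra.
have q2_in : p1 <= q2 <= p2 by lra.
apply: (@window_arith _ alpha b m e w c (h q1) (h q2) (32 * e / (alpha * w)) k) => //.
(* At [q1] the giant event alone keeps the mean density from lying far below [c]. *)
- move=> hc; rewrite yE; apply: (@dens_deviation _ _ (giant c)) => //.
  + by rewrite ler_wpM2l // mulr_ge0.
  + by have /andP[+ _] := prob_giant_between q1_in; apply: le_trans; lra.
  + by move=> x /dens_ge_giant gx; apply: sqr_dist_le.
(* At [q2] the absence of a giant forces the density to be at most [c] only when no two big clusters
   coexist; this joint event keeps probability [alpha / 2]. *)
- move=> hc; rewrite yE.
  apply: (@dens_deviation _ _ (fun w => ~~ giant c w && ~~ multi w)) => //.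
  + by rewrite ler_wpM2l // mulr_ge0.
  + apply: (prob_one_big_ge q2_in w8) => //.
    by rewrite mulrA ler_pdivrMr //; lra.
  + move=> x /andP[ng nm]; rewrite -sqrrN -[leRHS]sqrrN !opprB.
    exact: sqr_dist_ge hc (dens_lt_notgiant ng nm).
move=> mh1 mh2; have q12 : q1 < q2 by lra.
have [q /andP[qa qb] E] := expect_mvt s dens q12.
rewrite -/(h q1) -/(h q2) -/(dh q) in E.
have h_le x y : 0 <= x -> x <= y -> y <= 1 -> h x <= h y.
  by move=> ? ? ?; apply: expect_homo => //; exact: dens_nondecr.
have kdh : k <= dh q.
  apply: (growth_rate m0 kE); first by lra.
    by apply: le_trans mh1 (h_le _ _ _ _ _); lra.
  by apply: le_trans (h_le _ _ _ _ _) mh2; lra.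
have k0 : 0 <= k by rewrite kE divr_ge0 ?mulr_ge0 ?sqr_ge0 //; lra.
by rewrite E ler_pM //; lra.
Qed.

End Window.

(** * Choice of parameters and the final bound *)

Lemma two_clusters_rate_le (R : realFieldType) (x a a0 N M : R) (B r : nat) :
  0 < x -> 0 <= a -> a <= a0 -> 16 * a0 ^+ 2 <= B%:R -> (0 < r)%N ->
  (B ^ r)%:R <= N -> 0 < N -> x * N / r%:R <= M ->
  8 * a ^+ (r + r) * N ^+ 2 / M ^+ 3 <= 8 / x ^+ 3 / r%:R.
Proof.
move=> x0 a_ge0 aa0 Ba r0 BN N0 xM.
have r0' : 0 < r%:R :> R by rewrite ltr0n.
have t0 : 0 < x * N / r%:R by rewrite divr_gt0 // mulr_gt0.
have M0 : 0 < M by apply: lt_le_trans xM.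
(* [B ^ r] pays for [a0 ^ (r + r)] and for [16 ^ r = (2 ^ r) ^ 4], which exceeds [r ^ 4]; three of
   these powers go to [M ^ 3], and [1 / r] remains. *)
have ar : a ^+ (r + r) * r%:R ^+ 4 <= N.
  apply: le_trans BN; rewrite natrX; apply: (@le_trans _ _ ((16 * a0 ^+ 2) ^+ r)); last first.
    by apply: lerXn2r => //; rewrite nnegrE ?ler0n // mulr_ge0 ?sqr_ge0 ?ler0n.
  have -> : (16 * a0 ^+ 2) ^+ r = a0 ^+ (r + r) * (2 ^+ r) ^+ 4.
    rewrite exprMn mulrC -(exprM a0 2 r) mul2n addnn exprAC; congr (_ * _ ^+ r).
    by rewrite -natrX.
  have a00 : 0 <= a0 by apply: le_trans aa0.
  apply: ler_pM; rewrite ?exprn_ge0 //; apply: lerXn2r; rewrite ?nnegrE ?exprn_ge0 //.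
  by rewrite -natrX ler_nat ltnW // ltn_expl.
have M3 : (x * N / r%:R) ^+ 3 <= M ^+ 3.
  by rewrite lerXn2r ?nnegrE // ltW.
rewrite ler_pdivrMr ?exprn_gt0 //.
apply: le_trans (ler_wpM2l _ M3); last first.
  by rewrite !divr_ge0 ?exprn_ge0 ?(ltW x0).
have -> : 8 / x ^+ 3 / r%:R * (x * N / r%:R) ^+ 3 = 8 * N ^+ 3 / r%:R ^+ 4.
  by field; rewrite !gt_eqF.
rewrite ler_pdivlMr ?exprn_gt0 //.
have := ler_wpM2r (sqr_ge0 N) ar; rewrite (exprS N 2); lra.
Qed.

Lemma edges_small (G : sgraph) : (#|vert G| <= 1)%N -> edges G = set0.
Proof.
move=> V1; apply/setP => e; rewrite in_set0; apply/edgesP => -[x [y [xy _]]].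
suff exy : x = y by rewrite exy adj_irr in xy.
exact: (fintype_le1P V1).
Qed.

Lemma prob_giant_small (R : realType) (G : sgraph) (p q c : R) :
  (#|vert G| <= 1)%N -> prob_giant G p c = prob_giant G q c.
Proof.
by move=> /edges_small E0; rewrite !prob_giantE E0 enum_set0 !expect_nil.
Qed.

(** The radius [r] is the integer logarithm of [#|V|] in base [B], and [M] is about [x * #|V| / r]:
    balls of radius [r] are large enough to meet, while the cost [(2 * d / p1) ^ (r + r)] stays
    below [#|V| / r ^ 4]. *)
Lemma window_rate (R : realType) (b : R) (d : nat) (alpha c : R) :
  0 < b -> (0 < d)%N -> 0 < alpha < 2^-1 -> 0 < c < 1 ->
  exists B C, [/\ (1 < B)%N, 0 <= C & forall (G : sgraph) (p1 p2 : R),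
    maxdeg_le G d -> cheeger_gt G b -> (1 < #|vert G|)%N ->
    0 <= p1 -> p1 < p2 -> p2 <= 1 ->
    prob_giant G p1 c = alpha -> prob_giant G p2 c = 1 - alpha ->
    (p2 - p1) ^+ 3 * (trunc_log B #|vert G|)%:R <= C].
Proof.
move=> b0 d0 al c01; have [al0 al1] := andP al; have [c0 c1] := andP c01.
have d0' : 0 < d%:R :> R by rewrite ltr0n.
(* a0 bounds 2 d / p1: a cluster of c |V| vertices needs c |V| / 2 open edges,
   so that p1 >= alpha c / (2 d). *)
set a0 := 4 * d%:R ^+ 2 / (alpha * c) : R.
(* One successor makes [B] exceed [16 * a0 ^ 2]; the other ensures [1 < B]. *)
set B := (Num.trunc (16 * a0 ^+ 2)).+2.
set x := d%:R / b : R.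
have x0 : 0 < x by rewrite divr_gt0.
set m := Num.min c (1 - c) / 2.
have m0 : 0 < m by rewrite divr_gt0 // lt_min c0 subr_gt0.
have [mc m1c] : 2 * m <= c /\ 2 * m <= 1 - c.
  have -> : 2 * m = Num.min c (1 - c) by rewrite /m mulrC divfK ?pnatr_eq0.
  by rewrite !ge_min !lexx orbT.
set k := b * m ^+ 2 / (1 + 2 * b).
have b21 : 0 < 1 + 2 * b by lra.
have k0 : 0 < k by rewrite divr_gt0 // mulr_gt0 // exprn_gt0.
set C0 := 32 / (m ^+ 2 * alpha) + 512 / (alpha * k ^+ 2).
have C00 : 0 <= C0.
  by rewrite addr_ge0 // divr_ge0 // ltW // mulr_gt0 // exprn_gt0.
set C1 := 16 * (8 / x ^+ 3) / alpha.
have C10 : 0 <= C1 by rewrite divr_ge0 ?mulr_ge0 ?invr_ge0 ?exprn_ge0 ?(ltW x0) // ltW.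
(* From [r0] on, both [1 < c * N] and [M <= c * N] hold; for smaller [r] the trivial [w <= 1]
   suffices. *)
set r0 := (x + 1) / c.
have r00 : 0 <= r0 by rewrite divr_ge0 ?(ltW c0) //; lra.
have C0x : 0 <= C0 * (x + 1) by rewrite mulr_ge0 //; lra.
(* The terms serve, in order, the case where coexisting big clusters are rare enough for
   [window_le], the case where the window is too short for that, and small [r]. *)
exists B, (C0 * (x + 1) + C1 + r0); split => //; first by lra.
move=> G p1 p2 deg che V1 p10 p12 p21 f1 f2.
set r := trunc_log B _; set w := p2 - p1.
have w0 : 0 < w by rewrite subr_gt0.
have w3 : w ^+ 3 <= w.
  by rewrite exprS ler_piMr ?(ltW w0) // expr_le1 ?(ltW w0) //; rewrite /w; lra.
have w31 : w ^+ 3 <= 1 by apply: le_trans w3 _; rewrite /w; lra.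
have [rr|rr] := ltP r%:R r0.
  have : w ^+ 3 * r%:R <= 1 * r%:R by rewrite ler_wpM2r.
  lra.
have rpos : 0 < r%:R :> R by apply: lt_le_trans rr; rewrite divr_gt0 //; lra.
have rpos' : (0 < r)%N by rewrite -(ltr_nat R).
set N := #|vert G|%:R : R.
have N0 : 0 < N by rewrite ltr0n ltnW.
have BN : (B ^ r)%:R <= N by rewrite ler_nat trunc_logP // ltnW.
have rN : r%:R <= N by apply: le_trans BN; rewrite ler_nat ltnW // ltn_expl.
have cN : x + 1 <= c * N.
  rewrite mulrC -ler_pdivrMr //; exact: le_trans rr rN.
have p1_ge : alpha * c / (2 * d%:R) <= p1.
  have p101 : 0 <= p1 <= 1 by rewrite p10; lra.
  have cN1 : 1 < c * #|vert G|%:R by rewrite -/N; lra.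
  have := prob_giant_le deg p101 cN1; rewrite f1 natrM -/N => H.
  rewrite ler_pdivrMr ?mulr_gt0 // -(ler_pM2r N0); lra.
have p1_gt0 : 0 < p1 by apply: lt_le_trans p1_ge; rewrite divr_gt0 ?mulr_gt0.
have aa0 : 2 * d%:R / p1 <= a0.
  have -> : a0 = 2 * d%:R / (alpha * c / (2 * d%:R)).
    by rewrite /a0; field; rewrite !gt_eqF.
  by rewrite ler_wpM2l ?mulr_ge0 // lef_pV2 // posrE divr_gt0 ?mulr_gt0.
(* Rounding up preserves [d * N <= M * r * b]; as [r <= N], the extra 1 is at most [N / r]. *)
pose M := (Num.trunc (x * N / r%:R)).+1.
have xN0 : 0 <= x * N / r%:R by rewrite divr_ge0 // mulr_ge0 // ltW.
have M_ge : x * N / r%:R <= M%:R by rewrite ltW // truncnS_gt.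
have M_le : M%:R <= (x + 1) * (N / r%:R).
  rewrite /M -natr1 mulrDl mul1r mulrA lerD ?truncn_le //.
  by rewrite ler_pdivlMr // mul1r.
have MN : (d * #|vert G|)%:R <= M%:R * r%:R * b.
  move: M_ge; rewrite ler_pdivrMr // /x mulrAC ler_pdivrMr // natrM.
  by [].
have Mc : M%:R <= c * #|vert G|%:R.
  apply: le_trans M_le _; rewrite mulrCA mulrC ler_wpM2r ?(ltW N0) //.
  by rewrite ler_pdivrMr // mulrC -ler_pdivrMr.
have rate : 8 * (2 * d%:R / p1) ^+ (r + r) * N ^+ 2 / (M ^ 3)%:R <= 8 / x ^+ 3 / r%:R.
  rewrite natrX; apply: (two_clusters_rate_le x0 _ aa0 _ rpos' BN N0 M_ge).
    by rewrite divr_ge0 ?mulr_ge0.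
  by apply: ltW; apply: lt_le_trans (truncnS_gt _) _; rewrite ler_nat.
have [small|large] := leP (16 * (8 * (2 * d%:R / p1) ^+ (r + r) * N ^+ 2 / (M ^ 3)%:R)) (alpha * w).
  have := window_le b0 d0 al deg che (ltn0Sn _ : (0 < M)%N) MN c01 Mc N0 p1_gt0 p12 p21 f1 f2
    m0 mc m1c erefl small.
  rewrite -/w -/k -/C0 -/N => W.
  have : C0 * (M%:R / N) <= C0 * ((x + 1) / r%:R).
    rewrite ler_wpM2l // ler_pdivrMr //; apply: le_trans M_le _.
    by rewrite mulrA mulrAC.
  move/(le_trans W); rewrite mulrA ler_pdivlMr //; lra.
have : alpha * w <= 16 * (8 / x ^+ 3 / r%:R) by lra.
rewrite mulrA ler_pdivlMr // -mulrA mulrC -ler_pdivlMr // -/C1 => W.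
have : w ^+ 3 * r%:R <= w * r%:R by rewrite ler_wpM2r.
lra.
Qed.

Theorem theorem4p1 (R : realType) (b : R) (d : nat) (alpha c : R) :
  0 < b -> (0 < d)%N -> 0 < alpha < 2^-1 -> 0 < c < 1 ->
  exists C3 : R, forall G : nat -> sgraph, expander b d G ->
    forall (n : nat) (p_alpha p_1alpha : R),
      0 <= p_alpha <= 1 -> prob_giant (G n) p_alpha c = alpha ->
      0 <= p_1alpha <= 1 -> prob_giant (G n) p_1alpha c = 1 - alpha ->
      p_1alpha - p_alpha <= C3 / powR (ln (#|vert (G n)|)%:R) (3^-1).
Proof.
move=> b0 d0 al c01; have [B [C [B1 C0 H]]] := window_rate b0 d0 al c01.
have lnB : 0 < ln (B%:R : R) by rewrite ln_gt0 // ltr1n.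
(* [ln B] converts the integer logarithm into [ln #|V|], [C + 1] allows for [r + 1] in place of [r],
   and the last 1 gives [C3 <= C3 ^ 3], used after cubing the claim. *)
exists (ln (B%:R : R) * (C + 1) + 1) => G [deg che _] n p1 p2 /andP[p10 p11] f1 /andP[p20 p21] f2.
set L := ln (#|vert (G n)|%:R : R); set C3 := _ + 1.
have C30 : 1 <= C3 by rewrite lerDr mulr_ge0 ?(ltW lnB) //; lra.
have [p12|p12] := leP p2 p1.
  by apply: (@le_trans _ _ 0); rewrite ?subr_le0 // divr_ge0 ?powR_ge0 //; lra.
(* With at most one vertex there are no edges, so the probability is constant in [p], whereas
   [alpha < 1 - alpha]. *)
have [V1|V1] := leqP #|vert (G n)| 1.
  have := prob_giant_small p1 p2 c V1; rewrite f1 f2 => E; exfalso.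
  by case/andP: al; lra.
have L0 : 0 < L by rewrite ln_gt0 // ltr1n.
have W := H _ _ _ (deg n) (che n) V1 p10 p12 p21 f1 f2.
set r := trunc_log B _ in W; set w := p2 - p1 in W *.
have w0 : 0 < w by rewrite subr_gt0.
have w31 : w ^+ 3 <= 1 by rewrite expr_le1 ?(ltW w0) //; rewrite /w; lra.
have Lr : L <= (r%:R + 1) * ln B%:R.
  have B0 : 0 < B%:R :> R by rewrite ltr0n ltnW.
  have N0 : 0 < #|vert (G n)|%:R :> R by rewrite ltr0n ltnW.
  rewrite natr1 mulr_natl -lnXn // ler_ln ?posrE ?exprn_gt0 // -natrX ler_nat.
  by rewrite ltnW // trunc_log_ltn.
set y := powR L 3^-1.
have y0 : 0 < y by rewrite powR_gt0.
have y3 : y ^+ 3 = L by rewrite -powR_mulrn ?(ltW y0) // -powRrM mulVf ?pnatr_eq0 // powRr1 // ltW.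
rewrite ler_pdivlMr // -(@ler_pXn2r _ 3) ?nnegrE ?mulr_ge0 ?(ltW w0) ?(ltW y0) //; last by lra.
rewrite exprMn y3; apply: (@le_trans _ _ C3); last first.
  by rewrite exprS ler_peMr ?exprn_ege1 //; lra.
have : w ^+ 3 * L <= w ^+ 3 * ((r%:R + 1) * ln B%:R) by rewrite ler_wpM2l // exprn_ge0 // ltW.
have : ln B%:R * (w ^+ 3 * r%:R + w ^+ 3) <= ln B%:R * (C + 1).
  by rewrite ler_wpM2l ?(ltW lnB) // lerD.
rewrite /C3; lra.
Qed.
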